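(* Consider the single-pilot full-guard OTFS pattern on a $K\times M$ delay--Doppler grid, with pilot at $(k_p,m_p)$ satisfying $L-1\le k_p\le K-L$. For every BEM basis matrix $\boldsymbol{\Phi}\in\mathbb{C}^{N\times Q}$, this pattern satisfies the zero pilot--data interference condition $$\mathbf{R}_{pu}(\mathbf{s}_u)=\boldsymbol{\Psi}_p^H\boldsymbol{\Psi}_u(\mathbf{s}_u)=\mathbf{0}\quad\text{for all payload symbol vectors }\mathbf{s}_u,$$ where $\boldsymbol{\Psi}_p=\mathbf{Z}_p\mathbf{B}$ and $\boldsymbol{\Psi}_u(\mathbf{s}_u)=\mathbf{Z}_u\mathbf{B}$ are the time-domain pilot and payload observation matrices.
   Context: Let $K,M,L,Q$ be positive integers and $N=KM$. The delay--Doppler grid is a matrix $\mathbf{S}\in\mathbb{C}^{K\times M}$ with rows (delay bins) indexed by $k\in\{0,\ldots,K-1\}$ and columns (Doppler bins) by $m\in\{0,\ldots,M-1\}$. Single-pilot full-guard pattern: for a pilot position $(k_p,m_p)$ and pilot symbol $s_p\in\mathbb{C}$, $\mathbf{S}[k_p,m_p]=s_p$; $\mathbf{S}[k,m]=0$ whenever $k_p-L+1\le k\le k_p+L-1$, $0\le m\le M-1$ and $(k,m)\ne(k_p,m_p)$; and $\mathbf{S}[k,m]=s_u[k,m]$ (an arbitrary payload symbol) at all other cells. The collection of the $s_u[k,m]$ is denoted $\mathbf{s}_u$. Write $\mathbf{S}=\mathbf{S}_{\mathrm{pilot}}+\mathbf{S}_{\mathrm{payload}}$ for the parts containing only the pilot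 symbol and only the payload symbols (zeros elsewhere). The OTFS modulator is $\mathbf{x}=(\mathbf{F}_M^H\otimes\mathbf{I}_K)\,\mathrm{vec}(\mathbf{S})\in\mathbb{C}^N$, where $\mathrm{vec}$ stacks columns and $\mathbf{F}_M$ is the unitary $M$-point DFT matrix, $[\mathbf{F}_M]_{a,b}=M^{-1/2}e^{-j2\pi ab/M}$. Let $\mathbf{x}_p=(\mathbf{F}_M^H\otimes\mathbf{I}_K)\mathrm{vec}(\mathbf{S}_{\mathrm{pilot}})$ and $\mathbf{x}_u=(\mathbf{F}_M^H\otimes\mathbf{I}_K)\mathrm{vec}(\mathbf{S}_{\mathrm{payload}})$. With a cyclic prefix, the shifted vectors are $\mathbf{z}_{p,\ell}=\boldsymbol{\Pi}^\ell\mathbf{x}_p$, $\mathbf{z}_{u,\ell}=\boldsymbol{\Pi}^\ell\mathbf{x}_u$, $\ell=0,\ldots,L-1$, where $(\boldsymbol{\Pi}^\ell\mathbf{x})[n]=\mathbf{x}[(n-\ell)\bmod N]$. Set $\mathbf{Z}_p=[\mathrm{diag}(\mathbf{z}_{p,0}),\ldots,\mathrm{diag}(\mathbf{z}_{p,L-1})]$ and $\mathbf{Z}_u=[\mathrm{diag}(\mathbf{z}_{u,0}),\ldots,\mathrm{diag}(\mathbf{z}_{u,L-1})]$, both in $\mathbb{C}^{N\times NL}$, and $\mathbf{B}=\mathbf{I}_L\otimes\boldsymbol{\Phi}\in\mathbb{C}^{NL\times QL}$. *)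

(* Defs.v *)
From mathcomp Require Import all_boot all_order all_algebra.
From mathcomp Require Import complex mxtens.
From mathcomp Require Import reals trigo.

Set Implicit Arguments.
Unset Strict Implicit.
Unset Printing Implicit Defensive.

Import Order.TTheory GRing.Theory Num.Theory.

#[global] Open Scope ring_scope.
#[global] Open Scope complex_scope.
#[global] Open Scope sesquilinear_scope.

(* Index (i, j) of a Kronecker product is i * q + j.  All dimensions below are
   ordered accordingly, so that the signal length N = K M is typed as M * K. *)

(* Column stacking: entry m * K + k is S k m.  The library's [mxvec] stacks
   rows instead. *)
Definition vec (T : Type) (K M : nat) (S : 'M[T]_(K, M)) : 'cV[T]_(M * K) :=
  \col_i S (mxtens_unindex i).2 (mxtens_unindex i).1.

(* The block row [A 0, ..., A (L - 1)].  This is [\mxrow] up to a cast of the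
   width \sum_(l < L) n to L * n. *)
Definition hcat (T : Type) (m n L : nat) (A : 'I_L -> 'M[T]_(m, n)) :
    'M[T]_(m, L * n) :=
  \matrix_(i, c) A (mxtens_unindex c).1 i (mxtens_unindex c).2.

Lemma cshift_subproof (N l : nat) (n : 'I_N) :
  (`|((n : nat)%:Z - l%:Z) %% N%:Z|%Z < N)%N.
Proof.
have N0 : (0 < N)%N by case: n => n; apply: leq_ltn_trans.
rewrite -ltz_nat gez0_abs ?modz_ge0 -?lt0n //.
by rewrite ltz_pmod.
Qed.

(* (Pi^l x)[n] = x[(n - l) mod N], the residue being taken in int. *)
Definition cshift (T : Type) (N l : nat) (x : 'cV[T]_N) : 'cV[T]_N :=
  \col_n x (Ordinal (cshift_subproof l n)) 0.

(* exp(j t) *)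
Definition expj (R : realType) (t : R) : R[i] := cos t +i* sin t.

Definition dft (R : realType) (M : nat) : 'M[R[i]]_M :=
  \matrix_(a, b)
    (((Num.sqrt M%:R)^-1)%:C * expj (- (2 * pi * (a * b)%:R / M%:R))).

Definition otfs_mod (R : realType) (K M : nat) (S : 'M[R[i]]_(K, M)) :
    'cV[R[i]]_(M * K) :=
  (dft R M ^t* *t (1%:M : 'M[R[i]]_K)) *m vec S.

(* kp - L + 1 <= k <= kp + L - 1, rearranged to avoid truncated subtraction. *)
Definition guard_row (K L : nat) (kp k : 'I_K) : bool :=
  (kp + 1 <= k + L)%N && (k + 1 <= kp + L)%N.

Definition payload_cell (K M L : nat) (kp : 'I_K) (mp : 'I_M) : Type :=
  {c : 'I_K * 'I_M | (c != (kp, mp)) && ~~ guard_row L kp c.1}.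

Section SinglePilotFullGuard.

Variables (R : realType) (K M L : nat) (kp : 'I_K) (mp : 'I_M).

Definition pilot_grid (sp : R[i]) : 'M[R[i]]_(K, M) :=
  \matrix_(k, m) if (k, m) == (kp, mp) then sp else 0.

Definition payload_grid (su : payload_cell L kp mp -> R[i]) :
    'M[R[i]]_(K, M) :=
  \matrix_(k, m) oapp su 0 (insub (k, m)).

Definition dd_grid (sp : R[i]) (su : payload_cell L kp mp -> R[i]) :
    'M[R[i]]_(K, M) :=
  \matrix_(k, m)
    if (k, m) == (kp, mp) then sp
    else if guard_row L kp k then 0
    else oapp su 0 (insub (k, m)).

Lemma dd_grid_split sp su : dd_grid sp su = pilot_grid sp + payload_grid su.
Proof.
apply/matrixP => k m; rewrite !mxE; case: ifPn => [/eqP e|ne].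
  by rewrite insubF ?addr0 // e eqxx.
case: ifPn => [g|_]; last by rewrite add0r.
by rewrite insubF ?addr0 //= g andbF.
Qed.

End SinglePilotFullGuard.

(* Z B = [diag(x), diag(Pi x), ..., diag(Pi^(L-1) x)] (I_L (x) Phi) *)
Definition obs_mx (R : realType) (N Q L : nat) (Phi : 'M[R[i]]_(N, Q))
    (x : 'cV[R[i]]_N) : 'M[R[i]]_(N, L * Q) :=
  hcat (fun l : 'I_L => diag_mx (cshift l x)^T) *m ((1%:M : 'M[R[i]]_L) *t Phi).

Definition Psi_p (R : realType) (K M L Q : nat) (kp : 'I_K) (mp : 'I_M)
    (Phi : 'M[R[i]]_(M * K, Q)) (sp : R[i]) : 'M[R[i]]_(M * K, L * Q) :=
  obs_mx L Phi (otfs_mod (pilot_grid kp mp sp)).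

Definition Psi_u (R : realType) (K M L Q : nat) (kp : 'I_K) (mp : 'I_M)
    (Phi : 'M[R[i]]_(M * K, Q)) (su : payload_cell L kp mp -> R[i]) :
    'M[R[i]]_(M * K, L * Q) :=
  obs_mx L Phi (otfs_mod (payload_grid su)).

Definition R_pu (R : realType) (K M L Q : nat) (kp : 'I_K) (mp : 'I_M)
    (Phi : 'M[R[i]]_(M * K, Q)) (sp : R[i])
    (su : payload_cell L kp mp -> R[i]) : 'M[R[i]]_(L * Q) :=
  Psi_p L kp mp Phi sp ^t* *m Psi_u Phi su.

Definition zero_pilot_data_interference (R : realType) (K M L Q : nat)
    (kp : 'I_K) (mp : 'I_M) (Phi : 'M[R[i]]_(M * K, Q)) (sp : R[i]) : Prop :=
  forall su : payload_cell L kp mp -> R[i], R_pu Phi sp su = 0.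

(* Main.v *)
(* The DFT acts along the Doppler axis only, so entry n of the modulated signal
   depends only on the delay row n mod K.  The pilot copy delayed by l1 thus
   lives on n = kp + l1 mod K.  At such n, the payload copy delayed by l2 reads
   row kp + l1 - l2 mod K; the bounds on kp keep kp + l1 - l2 inside [0, K), so
   this row is a guard row, where the payload vanishes. *)
From Pilot Require Import Defs.
From mathcomp Require Import all_boot all_order all_algebra.
From mathcomp Require Import complex mxtens.
From mathcomp Require Import reals trigo.
From mathcomp Require Import zify.

Set Implicit Arguments.
Unset Strict Implicit.
Unset Printing Implicit Defensive.

Import Order.TTheory GRing.Theory Num.Theory.

(** Every column of [A] has support disjoint from every column of [B], so the columns are
    orthogonal. *)
Lemma adjmx_mul_eq0 (R : realType) (m n p : nat) (A : 'M[R[i]]_(m, n))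
    (B : 'M[R[i]]_(m, p)) :
  (forall i j k, A i j = 0 \/ B i k = 0) -> A ^t* *m B = 0.
Proof.
move=> AB0; apply/matrixP => j k; rewrite mxE [RHS]mxE big1 // => i _.
rewrite [(map_mx _ _) _ _]mxE [(_^T) _ _]mxE.
by case: (AB0 i j k) => ->; rewrite ?mulr0 // rmorph0 mul0r.
Qed.

Lemma tensmx1E (R : comPzRingType) (m n p : nat) (A : 'M[R]_(m, n)) i j :
  (A *t (1%:M : 'M_p)) i j =
  A (mxtens_unindex i).1 (mxtens_unindex j).1
    *+ ((mxtens_unindex i).2 == (mxtens_unindex j).2).
Proof. by rewrite /tensmx mxE [_%:M _ _]mxE mulr_natr. Qed.

Lemma otfs_mod_eq0 (R : realType) (K M : nat) (S : 'M[R[i]]_(K, M))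
    (i : 'I_(M * K)) :
  (forall m, S (mxtens_unindex i).2 m = 0) -> otfs_mod S i 0 = 0.
Proof.
move=> S0; rewrite /otfs_mod mxE big1 // => j _; rewrite tensmx1E [vec S _ _]mxE.
by case: (_ =P _) => [<-|_]; rewrite ?S0 ?mulr0 // mulr0n mul0r.
Qed.

Lemma cshift_otfs_mod_eq0 (R : realType) (K M l : nat) (S : 'M[R[i]]_(K, M))
    (n : 'I_(M * K)) :
  (forall (k : 'I_K) m, (k%:Z = n%:Z - l%:Z %[mod K])%Z -> S k m = 0) ->
  cshift l (otfs_mod S) n 0 = 0.
Proof.
move=> S0; rewrite /cshift mxE; apply: otfs_mod_eq0 => m; apply: S0 => /=.
have MK0 : (M * K)%N != 0%N by case: n => n /=; case: (M * K)%N.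
rewrite -modz_nat modz_mod gez0_abs ?modz_ge0 //.
(* As [K] divides [M * K], the wrap-around of the cyclic shift does not change the delay row. *)
rewrite {2}(divz_eq (n%:Z - l%:Z) (M * K)%N%:Z) PoszM mulrA.
by rewrite modzMDl.
Qed.

Lemma obs_mxE (R : realType) (N Q L : nat) (Phi : 'M[R[i]]_(N, Q))
    (x : 'cV[R[i]]_N) (n : 'I_N) (c : 'I_(L * Q)) :
  obs_mx L Phi x n c =
  cshift (mxtens_unindex c).1 x n 0 * Phi n (mxtens_unindex c).2.
Proof.
(* One term survives: the identity factor selects the block of [c], and that block, being diagonal,
   selects position [n]. *)
rewrite /obs_mx mxE (bigD1 (mxtens_index ((mxtens_unindex c).1, n))) //.
have E j : (hcat (fun l : 'I_L => diag_mx (cshift l x)^T)) n j =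
    cshift (mxtens_unindex j).1 x n 0 *+ (n == (mxtens_unindex j).2).
  by rewrite /hcat mxE [diag_mx _ _ _]mxE [_^T _ _]mxE.
rewrite big1 => [|j jn].
  rewrite [LHS]addr0 E mxtens_indexK eqxx [(_ *t _) _ _]mxE mxtens_indexK.
  by rewrite [_%:M _ _]mxE eqxx mul1r.
rewrite E [(_ *t _) _ _]mxE [_%:M _ _]mxE; move: jn.
rewrite -{1}[j]mxtens_unindexK (can_eq (@mxtens_indexK _ _)).
case: (mxtens_unindex j) => l n' /=; rewrite xpair_eqE.
case: eqP => [->|_] /=; last by rewrite mul0r mulr0.
by rewrite eq_sym => /negPf ->; rewrite mul0r.
Qed.

Lemma obs_mx_eq0 (R : realType) (N Q L : nat) (Phi : 'M[R[i]]_(N, Q))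
    (x : 'cV[R[i]]_N) (n : 'I_N) (c : 'I_(L * Q)) :
  cshift (mxtens_unindex c).1 x n 0 = 0 -> obs_mx L Phi x n c = 0.
Proof. by move=> x0; rewrite obs_mxE x0 mul0r. Qed.

Theorem proposition3 (R : realType) (K M L Q : nat)
    (hK : (0 < K)%N) (hM : (0 < M)%N) (hL : (0 < L)%N) (hQ : (0 < Q)%N)
    (kp : 'I_K) (mp : 'I_M)
    (hlo : (L - 1 <= kp)%N) (hhi : (kp + L <= K)%N)
    (sp : R[i]) (Phi : 'M[R[i]]_(M * K, Q)) :
  zero_pilot_data_interference L kp mp Phi sp.
Proof.
move=> su; rewrite /R_pu; apply: adjmx_mul_eq0 => n c d.
set l1 := (mxtens_unindex c).1; set l2 := (mxtens_unindex d).1.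
(* Split on whether time [n] reads the pilot row after delay [l1]: if so the payload factor
   vanishes, otherwise the pilot factor does. *)
have [/eqP kp_delay|kp_delay] :=
  boolP ((kp%:Z == n%:Z - (l1 : nat)%:Z %[mod K])%Z); [right|left];
  apply: obs_mx_eq0; apply: cshift_otfs_mod_eq0 => k m k_delay; last first.
  rewrite /pilot_grid mxE xpair_eqE.
  by case: (k =P kp) k_delay kp_delay => [-> ->|]; rewrite ?eqxx.
have [l1L l2L] := (ltn_ord l1, ltn_ord l2).
(* The congruence modulo [K] is an equality: [hlo] and [hhi] put the right-hand side in [0, K),
   since [l1] and [l2] differ by at most L - 1. *)
have {k_delay} kE : (k%:Z = kp%:Z + (l1 : nat)%:Z - (l2 : nat)%:Z)%R.
  rewrite -[LHS](@modz_small _ K); last by have := ltn_ord k; lia.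
  rewrite k_delay -/l2.
  rewrite -[RHS](@modz_small _ K); last by lia.
  by rewrite -addrA -[in RHS]modzDml kp_delay modzDml; congr (modz _ _); lia.
(* Row [k] is within L - 1 of [kp], so [insub] fails and the default 0 is read. *)
rewrite /payload_grid mxE insubF //= /guard_row.
by apply/negbTE; rewrite negb_and negbK; apply/orP; right; lia.
Qed.
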